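(* (1) There are $2^{\mathfrak{c}}$-many Tukey types ($=_T$-classes) of $\mathbf{k}(M)$, for $M$ separable metrizable. (2) There is a family $\mathcal{N}$ of separable metrizable spaces, of size $2^{\mathfrak{c}}$, such that if $M$ and $N$ are distinct elements of $\mathcal{N}$ then $\mathbf{k}(M)\not\ge_T\mathbf{k}(N)$. (3) Each of the ordered sets $\mathfrak{c}^+$, $I$ and $(\mathbb{P}(\omega),\subseteq)$ order-embeds in $\mathbf{k}(\mathcal{M})$ under the Tukey order.
   Context: A relation is a triple $\mathbf{A}=(A_-,A_+,A)$ of sets $A_-,A_+$ and a binary predicate $xAy$ for $x\in A_-$, $y\in A_+$. A (Tukey) morphism from $\mathbf{A}$ to $\mathbf{B}$ is a pair $(\psi_-,\phi_+)$ of functions $\psi_-:B_-\to A_-$, $\phi_+:A_+\to B_+$ such that $\psi_-(b)\,A\,a$ implies $b\,B\,\phi_+(a)$ for all $b\in B_-$, $a\in A_+$. Write $\mathbf{A}\ge_T\mathbf{B}$ (also $\mathbf{B}\le_T\mathbf{A}$) if there is such a morphism, and $\mathbf{A}=_T\mathbf{B}$ if $\mathbf{A}\ge_T\mathbf{B}$ and $\mathbf{B}\ge_T\mathbf{A}$. For a space $X$: $\mathrm{NC}(X)$ is the set of non-closed subsets of $X$; $\mathcal{K}(X)$ is the set of compact subsets; $S\,(\neg c)\,T$ means that $S\cap T$ is not closed in $T$; and $\mathbf{k}(X)=(\mathrm{NC}(X),\mathcal{K}(X),\neg c)$. $\mathbf{k}(\mathcal{M})$ is the collection of $=_T$-classes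 of $\mathbf{k}(M)$, $M$ separable metrizable, with the order induced by the Tukey relation (larger types being larger in $\ge_T$). $\mathfrak{c}$ is the cardinality of the continuum, $\mathfrak{c}^+$ its successor cardinal (as a well-ordered set), $I=[0,1]$ with its usual order, and $\mathbb{P}(\omega)$ the power set of $\omega$. *)

(* Defs.v *)
From HB Require Import structures.
From mathcomp Require Import all_boot all_order all_algebra.
From mathcomp Require Import all_classical all_reals all_analysis.
From mathcomp Require wochoice.

Set Implicit Arguments.
Unset Strict Implicit.
Unset Printing Implicit Defensive.
Import Order.TTheory GRing.Theory Num.Theory.

Local Open Scope classical_set_scope.
Local Open Scope ring_scope.
Local Open Scope card_scope.

Record tukey_relation := TukeyRelation {
  rel_minus : Type;
  rel_plus : Type;
  rel_holds : rel_minus -> rel_plus -> Prop }.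

Definition tukey_ge (A B : tukey_relation) : Prop :=
  exists (psi : rel_minus B -> rel_minus A) (phi : rel_plus A -> rel_plus B),
    forall b a, rel_holds (psi b) a -> rel_holds b (phi a).

Definition tukey_eq (A B : tukey_relation) : Prop := tukey_ge A B /\ tukey_ge B A.

Lemma tukey_ge_refl A : tukey_ge A A.
Proof. by exists id, id. Qed.

Lemma tukey_ge_trans A B C : tukey_ge A B -> tukey_ge B C -> tukey_ge A C.
Proof.
move=> [p [q pq]] [p' [q' pq']]; exists (p \o p'), (q' \o q) => b a /=.
by move/pq/pq'.
Qed.

(* [subspace T] lives on all of [X]; since [S `&` T] is contained in [T], its
   being closed there means being closed in [T] for the relative topology. *)
Definition kspace (X : topologicalType) : tukey_relation :=
  @TukeyRelation {S : set X | ~ closed S} {T : set X | compact T}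
    (fun S T => ~ closed (sval S `&` sval T : set (subspace (sval T)))).

Definition separable_space (X : topologicalType) : Prop :=
  exists D : set X, countable D /\ dense D.

Definition metrizable (R : realType) (X : topologicalType) : Prop :=
  exists d : X -> X -> R,
    [/\ forall x y, d x y = 0 <-> x = y,
        forall x y, d x y = d y x,
        forall x y z, d x z <= d x y + d y z &
        forall U : set X, open U <->
          forall x, U x -> exists2 e, 0 < e & [set y | d x y < e] `<=` U].

Lemma metricType_metrizable (R : realType) (M : metricType R) :
  metrizable R M.
Proof.
exists (@mdist R M); split.
- by move=> x y; split=> [|->]; [exact: mdist_positivity | exact: mdistxx].
- exact: metric_sym.
- exact: metric_triangle.
- move=> U; rewrite openE; split=> [Uo x /Uo|Uo x /Uo].
  + by rewrite /interior -nbhs_ballE => -[e e0 eU]; exists e => //;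
      rewrite -ballEmdist.
  + by move=> [e e0 eU]; rewrite /interior -nbhs_ballE; exists e => //;
      rewrite /= ballEmdist.
Qed.

Record sepMetrizable (R : realType) := SepMetrizable {
  sm_space :> topologicalType;
  sm_separable : separable_space sm_space;
  sm_metrizable : metrizable R sm_space }.

(* [sepMetrizable R] is too large for [set] and [#=], whose universes lie below
   that of [topologicalType]; collections of spaces are thus plain predicates
   and are compared through [equinumerous]. *)
Definition equinumerous (A B : Type) : Prop := exists f : A -> B, bijective f.

Definition tukey_class (R : realType) (M : sepMetrizable R) :
    sepMetrizable R -> Prop :=
  fun N => tukey_eq (kspace N) (kspace M).

Definition tukey_type (R : realType) : Type :=
  {C : sepMetrizable R -> Prop | exists M, C = tukey_class M}.

Definition tukey_type_le (R : realType) (C D : tukey_type R) : Prop :=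
  exists M N : sepMetrizable R,
    [/\ sval C M, sval D N & tukey_ge (kspace N) (kspace M)].

Lemma tukey_type_leP (R : realType) (C D : tukey_type R)
    (M N : sepMetrizable R) :
  sval C M -> sval D N ->
  tukey_type_le C D <-> tukey_ge (kspace N) (kspace M).
Proof.
have [[M0 CE] [N0 DE]] := (svalP C, svalP D).
rewrite /tukey_type_le CE DE => CM DN; split; last by exists M, N.
move=> [M' [N' [CM' DN' le]]].
apply: tukey_ge_trans DN.1 _; apply: tukey_ge_trans DN'.2 _.
by apply: tukey_ge_trans le _; exact: tukey_ge_trans CM'.1 CM.2.
Qed.

Lemma tukey_type_le_anti (R : realType) (C D : tukey_type R) :
  tukey_type_le C D -> tukey_type_le D C -> C = D.
Proof.
have [[M CE] [N DE]] := (svalP C, svalP D).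
have CM : sval C M by rewrite CE; split; exact: tukey_ge_refl.
have DN : sval D N by rewrite DE; split; exact: tukey_ge_refl.
move=> /(tukey_type_leP CM DN) NM /(tukey_type_leP DN CM) MN.
suff eqCD : sval C = sval D.
  by case: C D eqCD {CE DE CM DN} => C CP [D DP] /= eqCD; exact: eq_exist.
rewrite CE DE; apply/funext => P; apply/propext; split=> -[PM MP];
  by split; [apply: tukey_ge_trans PM _ | apply: tukey_ge_trans MP].
Qed.

Definition order_embeds (T U : Type) (leT : T -> T -> Prop)
    (leU : U -> U -> Prop) : Prop :=
  exists f : T -> U, forall x y, leT x y <-> leU (f x) (f y).

(* [(W, le)] is the initial ordinal of cardinality [|K|^+]: it is determined up
   to order isomorphism as the well-order that does not inject into [K] while
   all its proper initial segments do. *)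
Definition is_succ_cardinal (K : Type) (W : eqType) (le : rel W) : Prop :=
  [/\ wochoice.well_order le,
      ~ ([set: W] #<= [set: K]) &
      forall w, [set v | le v w /\ v <> w] #<= [set: K]].

Lemma card_le_setN (K : Type) : ~ ([set: set K] #<= [set: K]).
Proof.
move=> /card_leP[f].
pose g (A : set K) : K := val (f (SigSub (mem_set (I : [set: set K] A)))).
have g_inj : injective g.
  move=> A B /val_inj eq_fAB.
  have /(congr1 val) : SigSub (mem_set (I : [set: set K] A)) =
      SigSub (mem_set (I : [set: set K] B)) :> [set: set K].
    by apply: ('inj_f) => //; rewrite inE.
  by [].
pose D : set K := [set x | exists2 A, x = g A & ~ A x].
have [DgD|DgD] := pselect (D (g D)); last by apply: (DgD); exists D.
by have [A /g_inj DA] := DgD; rewrite -DA.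
Qed.

Lemma succ_cardinal_exists (K : Type) :
  exists (W : eqType) (le : rel W), is_succ_cardinal K le.
Proof.
have [r wor] := wochoice.well_ordering_principle (set K : eqType).
have worT : wochoice.wo_chain r predT by move=> A _; exact: wor.
have r_refl x : r x x by exact: (wochoice.wo_chain_reflexive worT).
have r_anti x y : r x y -> r y x -> x = y.
  move=> xy yx; apply: (wochoice.wo_chain_antisymmetric worT) => //.
  by rewrite xy.
pose seg x := [set y | r y x /\ y <> x].
have [[x0 x0K]|small] := pselect (exists x, ~ (seg x #<= [set: K])).
- have [|z [[]]] := wor (fun x => ~~ (seg x #<= [set: K])).
    by exists x0; apply/negP.
  rewrite unfold_in => zK zmin _.
  exists (set_type (seg z)), (fun x y => r (val x) (val y)); split.
  + apply: wochoice.antisymmetric_well_order.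
      by move=> x y /andP[xy yx]; exact/val_inj/r_anti.
    move=> A [a Aa].
    have [|w [[/asboolP[b bA bw]] wmin] _] :=
        wor (fun x => `[< exists2 b, b \in A & val b = x >]).
      by exists (val a); apply/asboolP; exists a.
    exists b; split => // c cA; rewrite bw; apply: wmin.
    by apply/asboolP; exists c.
  + by rewrite (card_le_eql (card_setT _)); apply/negP.
  + move=> w; have [wz wNz] := set_valP w.
    have wK : seg (val w) #<= [set: K].
      apply: contrapT => /negP wK; apply: wNz; apply: r_anti => //.
      by apply: zmin; rewrite unfold_in.
    apply: card_le_trans wK.
    rewrite -(card_le_eql (inj_card_eq (f := val) (in2W val_inj))).
    apply: subset_card_le => _ [v [vw vNw] <-]; split => // /val_inj.
    exact: vNw.
- exists (set K), r; split => //; first exact: card_le_setN.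
  by move=> w; apply: contrapT => wK; apply: small; exists w.
Qed.

(* Main.v *)
From Stdlib Require Import Wellfounded.
Require Import Defs.
From HB Require Import structures.
From mathcomp Require Import all_boot all_order all_algebra.
From mathcomp Require Import all_classical all_reals all_analysis.
From mathcomp Require Import lra.
From mathcomp Require wochoice.

Set Implicit Arguments.
Unset Strict Implicit.
Unset Printing Implicit Defensive.
Import Order.TTheory GRing.Theory Num.Theory.

Local Open Scope classical_set_scope.

(** The theorem rests on one reduction: a morphism from k(M) to k(N), although a
    pair of arbitrary functions on huge sets, leaves a trace that is a closed
    relation between points, and there are only continuum many closed relations.

    All the spaces built here are subspaces of the Cantor space nat -> bool.
    Let N be crowded, let (psi, phi) be a morphism from k(M) to k(N), and for x
    in N let g x be a limit of psi (N minus x) lying outside that set.  If g x_n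
    tends to m in M and x_n tends to y, then m, the points g x_n and sequences of
    psi (N minus x_n) that converge fast enough to g x_n form a compact K; every
    x_n must belong to the compact set phi K, for otherwise the trace of
    N minus x_n on phi K would be phi K itself, which is closed.  Hence y is in
    N: the closure D of the pairs (g x, x) sends points of M into N only, and it
    covers N.  Thus N = D[M] for a closed D (tukey_ge_prefix_rel).

    A transfinite diagonalization in the style of Sierpinski and Kuratowski
    against the continuum many closed relations then gives sets M_A, for A a set
    of points of the Cantor space, such that no closed relation maps M_A, or a
    countable disjoint sum of such sets, onto M_A' as soon as a single point
    separates A' from all the indices of the sum (diagonal_family).  In the other
    direction k(M) is above k(N) whenever N is a closed subspace of M
    (kspace_closed_embedding), as is every member of a disjoint sum, or of a
    family of up to continuum many spaces glued along the Cantor space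
    (gather_fiber).

    - The M_A are pairwise incomparable, so that there are at least as many types
      as sets of reals.  There are no more, because a space is coded by the traces
      of its points on a countable base.
    - Sending a set B of integers to the sum over k in B of the M_{spike k} embeds
      the power set of the integers; real numbers embed there as Dedekind cuts.
    - The M_A below a fixed space are given by distinct closed relations, so some
      M_A is not below it.  Hence continuum many spaces always have a strict upper
      bound, and well-founded recursion climbs along the successor of the
      continuum. *)

(** * Injections between types and recursion along well-orders *)

(** Stated between types rather than between sets, so that it also applies to
    the types of spaces and of Tukey types, which are too large to be compared
    through their sets of elements. *)
Definition embeds (A B : Type) : Prop := exists f : A -> B, injective f.

Lemma embeds_refl A : embeds A A.
Proof. by exists id. Qed.

Lemma embeds_trans A B C : embeds A B -> embeds B C -> embeds A C.
Proof. by move=> [f fI] [g gI]; exists (g \o f); exact: inj_comp. Qed.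

Lemma sval_inj T (P : T -> Prop) : injective (@sval T P).
Proof. by move=> [x px] [y py] /= xy; exact: eq_exist. Qed.

Lemma embeds_prod A B A' B' : embeds A A' -> embeds B B' -> embeds (A * B) (A' * B').
Proof.
move=> [f fI] [g gI]; exists (fun p => (f p.1, g p.2)) => -[a b] [c d] /=.
by move=> [/fI-> /gI->].
Qed.

Lemma embeds_sum A B A' B' : embeds A A' -> embeds B B' -> embeds (A + B) (A' + B').
Proof.
move=> [f fI] [g gI].
exists (fun s => match s with inl a => inl (f a) | inr b => inr (g b) end).
by move=> [a|b] [c|d] //= [] => [/fI->|/gI->].
Qed.

Lemma embeds_surj A B (g : A -> B) : (forall b, exists a, g a = b) -> embeds B A.
Proof.
move=> /choice[f fE]; exists f => x y fxy.
by rewrite -(fE x) fxy fE.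
Qed.

Lemma embeds_powerset A B : embeds A B -> embeds (set A) (set B).
Proof.
move=> [f fI]; exists (fun S => f @` S) => S T ST.
have sub U V : f @` U = f @` V -> U `<=` V.
  by move=> UV x Ux; have : (f @` U) (f x) by [exists x]; rewrite UV => -[y Vy /fI <-].
by apply/seteqP; split; apply: sub.
Qed.

(** The Cantor-Bernstein theorem at arbitrary universe levels, needed for the
    large types of spaces: f is used on the orbits under g o f of the points
    outside the range of g, and the inverse of g everywhere else. *)
Lemma equinumerous_of_embeds (A B : Type) :
  embeds A B -> embeds B A -> equinumerous A B.
Proof.
move=> [f fI] [g gI].
(* X collects the orbits of the points outside the range of g. *)
pose X a := exists n a0, (forall b, g b <> a0) /\ a = iter n (g \o f) a0.
have Xgf a : X a -> X (g (f a)).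
  by move=> [n [a0 [ga0 ->]]]; exists n.+1, a0.
have Xg b : X (g b) -> exists2 a, X a & f a = b.
  move=> [[|n] [a0 [ga0 /= e]]]; first by case: (ga0 b).
  by exists (iter n (g \o f) a0); [exists n, a0|exact/esym/gI].
have /choice[h hP] : forall a, exists b, (X a /\ b = f a) \/ (~ X a /\ g b = a).
  move=> a; have [Xa|Xa] := pselect (X a); first by exists (f a); left.
  have [[b ba]|no] := pselect (exists b, g b = a); first by exists b; right.
  by case: Xa; exists 0%N, a; split => // b ba; apply: no; exists b.
have /choice[k kP] : forall b, exists a, h a = b.
  move=> b; have [Xgb|Xgb] := pselect (X (g b)).
    have [a Xa <-] := Xg b Xgb; exists a.
    by have [[]|[]] := hP a.
  exists (g b); have [[]|[_ /gI]] := hP (g b); by [].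
exists h, k => // a; have ha := kP (h a).
have [[Xa e]|[Xa e]] := hP a; have [[Xb e']|[Xb e']] := hP (k (h a)).
- by apply: fI; rewrite -e -e' ha.
- by case: Xb; rewrite -e' ha e; exact: Xgf.
- by case: Xa; rewrite -e -ha e'; exact: Xgf.
- by rewrite -e' ha e.
Qed.

(** Recursion where each value is only known to satisfy a specification referring
    to the earlier values, and where a suitable value need exist only once those
    obey the specification.  It drives all the constructions by recursion of the
    file. *)
Lemma wf_rec_spec (W V : Type) (lt : W -> W -> Prop) (v0 : V)
    (P : W -> (W -> V) -> V -> Prop) :
  well_founded lt ->
  (forall w f g v, (forall u, lt u w -> f u = g u) -> P w f v -> P w g v) ->
  (forall w f, (forall u, lt u w -> P u f (f u)) -> exists v, P w f v) ->
  exists f : W -> V, forall w, P w f (f w).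
Proof.
move=> wf loc ex.
pose ext w (r : forall u, lt u w -> V) : W -> V := fun u =>
  match pselect (lt u w) with left h => r u h | right _ => v0 end.
pose F w r := match pselect (exists v, P w (@ext w r) v) with
  left h => sval (cid h) | right _ => v0 end.
pose f := Fix wf (fun=> V) F.
have fE w : f w = F w (fun u _ => f u).
  apply: Fix_eq => u r s rs; congr (F u _); apply: functional_extensionality_dep => x.
  by apply: functional_extensionality_dep => h; exact: rs.
exists f; apply: (well_founded_ind wf) => w IH.
have extE u : lt u w -> ext w (fun u _ => f u) u = f u.
  by move=> uw; rewrite /ext; case: pselect.
have [v Pv] := ex w f IH.
rewrite fE /F; case: pselect => [h|].
  by apply: loc (svalP (cid h)) => u /extE ->.
by case; exists v; apply: loc Pv => u /extE.
Qed.

Definition trichotomous W (lt : W -> W -> Prop) :=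
  forall u v, lt u v \/ u = v \/ lt v u.

Definition segment W (lt : W -> W -> Prop) (w : W) : Type := {u | lt u w}.

Lemma well_order_strict (W : eqType) (le : rel W) : wochoice.well_order le ->
  let lt := fun u v => le u v /\ u <> v in
  [/\ well_founded lt, trichotomous lt, (forall u v w, lt u v -> lt v w -> lt u w) &
    forall u v, le u v <-> ~ lt v u].
Proof.
move=> wo lt.
have min1 (S : set W) : S !=set0 -> exists z, S z /\ forall x, S x -> le z x.
  move=> [x Sx]; have [|z [[]]] := wo (fun x => `[< S x >]).
    by exists x; apply/asboolP.
  move=> /asboolP Sz zS _; exists z; split => // y Sy; apply: zS.
  by apply/asboolP.
have uniq (S : set W) y z : S y -> (forall x, S x -> le y x) -> S z ->
    (forall x, S x -> le z x) -> y = z.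
  move=> Sy yS Sz zS; have [|t [_ tu]] := wo (fun x => `[< S x >]).
    by exists y; apply/asboolP.
  have tE r : S r -> (forall x, S x -> le r x) -> t = r.
    move=> Sr rS; apply: tu; split; first exact/asboolP.
    by move=> x /asboolP; exact: rS.
  by rewrite -(tE y) // -(tE z).
have refl x : le x x.
  by have [|z [-> zx]] := min1 [set x]; [exists x | exact: zx].
have anti x y : le x y -> le y x -> x = y.
  move=> xy yx; apply: (uniq [set x; y]); rewrite /=; auto.
    by move=> z [->|->].
  by move=> z [->|->].
have tot x y : le x y \/ le y x.
  have [|z [[->|->] zx]] := min1 [set x; y]; first by exists x; left.
    by left; apply: zx; right.
  by right; apply: zx; left.
have trans y x z : le x y -> le y z -> le x z.
  move=> xy yz; have [|t [tm tx]] := min1 [set x; y; z]; first by exists x; left; left.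
  case: tm tx => [[|]|] -> tx; first by apply: tx; right.
    by rewrite (anti x y) //; apply: tx; left; left.
  by rewrite -(anti y z) //; apply: tx; left; right.
split.
- move=> w; apply: contrapT => wN.
  have [|z [zN zmin]] := min1 [set w | ~ Acc lt w]; first by exists w.
  apply: zN; constructor => y [yz yNz]; apply: contrapT => yN.
  by apply: yNz; apply: anti => //; exact: zmin.
- move=> u v; have [->|/eqP uv] := eqVneq u v; first by right; left.
  have [?|?] := tot u v; [by left|right; right; split => //].
  by move=> vu; exact: uv.
- move=> u v w [uv uNv] [vw vNw]; split; first exact: trans vw.
  by move=> uw; apply: vNw; apply: anti => //; rewrite -uw.
- move=> u v; split=> [uv [vu]|vu]; first by apply; exact: anti.
  have [//|vu'] := tot u v; apply: contrapT => uv; apply: vu; split => //.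
  by move=> vu; apply: uv; rewrite vu.
Qed.

Lemma well_order_exists (T : Type) : exists lt : T -> T -> Prop,
  [/\ well_founded lt, trichotomous lt & forall u v w, lt u v -> lt v w -> lt u w].
Proof.
pose T' : eqType := HB.pack T (gen_eqMixin T).
have [le wo] := wochoice.well_ordering_principle T'.
by exists (fun u v => le u v /\ u <> v); have [? ? ? _] := well_order_strict wo.
Qed.

(** A well-order on X all of whose proper initial segments violate Phi, obtained
    by cutting a well-order of X at the first segment with Phi.  With Phi saying
    that a fixed type embeds, this yields an initial ordinal. *)
Lemma minimal_type (Phi : Type -> Prop) (X : Type) :
  (forall A B, embeds A B -> embeds B A -> Phi A -> Phi B) ->
  Phi X -> exists (W : Type) (lt : W -> W -> Prop),
    [/\ well_founded lt, trichotomous lt, (forall u v w, lt u v -> lt v w -> lt u w),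
     Phi W & forall w, ~ Phi (segment lt w)].
Proof.
move=> inv PhiX; have [lt [wf tri trans]] := well_order_exists X.
have [[w Pw]|no] := pselect (exists w, Phi (segment lt w)); last first.
  by exists X, lt; split => // w Pw; apply: no; exists w.
move: w Pw; apply: (well_founded_ind wf) => w IH Pw.
have [[u [uw Pu]]|no] := pselect (exists u, lt u w /\ Phi (segment lt u)).
  exact: IH uw Pu.
exists (segment lt w), (fun u v => lt (sval u) (sval v)); split.
- exact: wf_inverse_image.
- move=> u v; have [?|[uv|?]] := tri (sval u) (sval v); [by left| |by right; right].
  by right; left; exact: sval_inj.
- by move=> ? ? ?; exact: trans.
- exact: Pw.
- move=> u Pu; apply: no; exists (sval u); split; first exact: svalP u.
  apply: inv Pu.
    exists (fun v : segment (fun u v : segment lt w => lt (sval u) (sval v)) u =>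
      exist (lt^~ (sval u)) (sval (sval v)) (svalP v)) => x y /(congr1 sval) /= xy.
    by apply: sval_inj; apply: sval_inj.
  exists (fun v : segment lt (sval u) =>
    exist (fun x : segment lt w => lt (sval x) (sval u))
     (exist (lt^~ w) (sval v) (trans _ _ _ (svalP v) (svalP u))) (svalP v)).
  move=> x y /(congr1 (fun t => sval (sval t))) /= xy.
  exact: sval_inj.
Qed.

(* greedy *)
(** Choose the images one after the other, each time outside the earlier ones:
    this never gets stuck when no initial segment maps onto S. *)
Lemma greedy_embeds T S (lt : T -> T -> Prop) :
  well_founded lt -> trichotomous lt ->
  (forall t, ~ embeds S (segment lt t)) -> embeds T S.
Proof.
move=> wf tri small.
have [[s0 _]|S0] := pselect (exists s : S, True); last first.
  have T0 (t : T) : False.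
    by apply: (small t); exists (fun s => False_rect _ (S0 (ex_intro _ s I))) => s; case: S0; exists s.
  by exists (fun t => False_rect _ (T0 t)) => t; case: (T0 t).
have [|||f fP] := @wf_rec_spec T S lt s0 (fun t f s => forall u, lt u t -> f u <> s).
- by [].
- by move=> t f g s fg Pf u ut; rewrite -fg //; exact: Pf.
- move=> t f _; apply: contrapT => no; apply: (small t).
  apply: (@embeds_surj _ _ (fun u : segment lt t => f (sval u))) => s.
  apply: contrapT => sN; apply: no; exists s => u ut us.
  by apply: sN; exists (exist _ u ut).
exists f => t u tu; have [h|[//|h]] := tri t u.
  by case: (fP _ _ h).
by case: (fP _ _ h).
Qed.

(** * Squares of infinite types *)

Local Notation slexprod := (@Relation_Operators.slexprod _ _).

Lemma trichotomous_slexprod A B (ltA : A -> A -> Prop) (ltB : B -> B -> Prop) :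
  trichotomous ltA -> trichotomous ltB ->
  trichotomous (slexprod ltA ltB).
Proof.
move=> tA tB [a b] [c d]; have [ac|[->|ca]] := tA a c.
- by left; left.
- have [bd|[->|db]] := tB b d; [by left; right|by right; left|].
  by right; right; right.
- by right; right; left.
Qed.

(** The integers come before all of W: this makes every initial segment of
    nat + W either finite or of the form nat + segment. *)
Definition sum_lt W (lt : W -> W -> Prop) :=
  @Relation_Operators.le_AsB nat W (fun m n => is_true (m < n)%N) lt.

Lemma sum_lt_wf W (lt : W -> W -> Prop) : well_founded lt -> well_founded (sum_lt lt).
Proof.
move=> wf; apply: wf_disjoint_sum; last exact: wf.
by move=> n; elim/ltn_ind: n => n IH; constructor; exact: IH.
Qed.

Lemma sum_lt_tri W (lt : W -> W -> Prop) : trichotomous lt -> trichotomous (sum_lt lt).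
Proof.
move=> tri [m|u] [n|v].
- by have [mn|nm|->] := ltngtP m n; [left|right; right|right; left]; constructor.
- by left; constructor.
- by right; right; constructor.
- by have [uv|[->|vu]] := tri u v; [left|right; left|right; right]; constructor.
Qed.

Lemma sum_lt_trans W (lt : W -> W -> Prop) : (forall u v w, lt u v -> lt v w -> lt u w) ->
  forall u v w, sum_lt lt u v -> sum_lt lt v w -> sum_lt lt u w.
Proof.
move=> trans [m|u] [n|v] [p|w] uv vw; inversion uv; inversion vw; subst; constructor.
  exact: ltn_trans H4.
exact: trans H4.
Qed.

Lemma countable_embeds (T : countType) : embeds T nat.
Proof. by exists pickle; exact: pcan_inj pickleK. Qed.

(** Every infinite cardinal equals its square.  Minimality of the counterexample
    W makes the pairs below a given pair, in Goedel's ordering by maximum first,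
    too few to exhaust T = nat + W; so T * T embeds in T greedily. *)
Lemma nat_sum_square A : embeds ((nat + A) * (nat + A)) (nat + A).
Proof.
apply: contrapT => NA.
have [|W [lt [wf tri trans NW sq]]] :=
    @minimal_type (fun A => ~ embeds ((nat + A) * (nat + A)) (nat + A)) A _ NA.
  move=> B C BC CB NB sqC; apply: NB.
  have nBC : embeds (nat + B) (nat + C) by apply: embeds_sum => //; exact: embeds_refl.
  apply: embeds_trans (embeds_prod nBC nBC) _; apply: embeds_trans sqC _.
  by apply: embeds_sum => //; exact: embeds_refl.
apply: NW; set T := (nat + W)%type.
pose le s t := sum_lt lt s t \/ s = t.
have leT s t r : le s t -> le t r -> le s r.
  move=> [st|->] // [tr|<-]; left => //; exact: sum_lt_trans tr.
(* It is enough to embed T in the square of a part of T equal to its square. *)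
have reduce U : embeds T (U * U) -> embeds (U * U) U -> embeds U T -> embeds (T * T) T.
  move=> TU UU UT; have {}TU := embeds_trans TU UU.
  by apply: embeds_trans (embeds_prod TU TU) _; exact: embeds_trans UU UT.
have [//|NTT] := pselect (embeds (T * T) T).
(* Hence T does not embed in the square of a closed initial segment. *)
have small t : ~ embeds T ({s | le s t} * {s | le s t}).
  move=> Tt; apply: NTT; case: t Tt => [n|w] Tt.
  - apply: (reduce nat); [|exact: countable_embeds|by exists inl => ? ? []].
    apply: embeds_trans Tt _.
    suff: embeds {s | le s (inl n)} nat by move=> h; exact: embeds_prod.
    exists (fun s => if sval s is inl m then m else 0).
    move=> [[m|u] su] [[p|v] sv] /= uv; apply: sval_inj => /=; rewrite ?uv //.
    + by case: sv => // h; inversion h.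
    + by case: su => // h; inversion h.
    + by case: su => // h; inversion h.
  - apply: (reduce (nat + segment lt w)%type); last first.
    + by apply: embeds_sum; [exact: embeds_refl|exists sval; exact: sval_inj].
    + exact: contrapT (sq w).
    apply: embeds_trans Tt _.
    suff: embeds {s | le s (inr w)} (nat + segment lt w) by move=> h; exact: embeds_prod.
    (* The integers are shifted to make room for w, sent to inl 0. *)
    pose f (s : T) : nat + segment lt w := match s with
      | inl m => inl m.+1
      | inr u => if pselect (lt u w) is left h then inr (exist _ u h) else inl 0 end.
    exists (fun s => f (sval s)) => -[[m|u] su] [[p|v] sv] /= uv;
      apply: sval_inj => /=; move: uv.
    + by case=> ->.
    + by case: pselect.
    + by case: pselect.
    + case: pselect => uw; case: pselect => vw //.
        by case=> ->.
      case: su => [h|[->]]; first by inversion h.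
      by case: sv => [h|[->]]; first by inversion h.
pose mx (p : T * T) := if pselect (sum_lt lt p.1 p.2) is left _ then p.2 else p.1.
have mx1 p : le p.1 (mx p).
  by rewrite /mx; case: pselect; [left|right].
have mx2 p : le p.2 (mx p).
  rewrite /mx; case: pselect => [?|h]; first by right.
  by have [//|[<-|]] := sum_lt_tri tri p.1 p.2; [right|left].
(* Goedel's ordering: by maximum first, then lexicographically. *)
pose ltTT p q := slexprod (sum_lt lt)
  (slexprod (sum_lt lt) (sum_lt lt)) (mx p, p) (mx q, q).
apply: (@greedy_embeds (T * T)%type T ltTT).
- apply: (wf_inverse_image (T * T) _ _ (fun p => (mx p, p))).
  by apply: wf_slexprod; [|apply: wf_slexprod]; exact: sum_lt_wf.
- move=> p q; have triT := sum_lt_tri tri.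
  have [pq|[[_ ->]|pq]] :=
    trichotomous_slexprod triT (trichotomous_slexprod triT triT) (mx p, p) (mx q, q).
  + by left.
  + by right; left.
  + by right; right.
- move=> q Tq; apply: (small (mx q)); apply: embeds_trans Tq _.
  have qP (p : segment ltTT q) : le (sval p).1 (mx q) /\ le (sval p).2 (mx q).
    have pq : le (mx (sval p)) (mx q).
      have := svalP p; rewrite /ltTT => h; inversion h; first by left.
      by right.
    by split; [exact: leT (mx1 _) pq|exact: leT (mx2 _) pq].
  exists (fun p => (exist (le^~ (mx q)) _ (qP p).1, exist (le^~ (mx q)) _ (qP p).2)).
  move=> p p' /= [] e1 e2; apply: sval_inj.
  by move: e1 e2; case: (sval p) (sval p') => [? ?] [? ?] /= -> ->.
Qed.

(** * Diagonalization against few relations *)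

(** Removing a countable part does not change the size of an uncountable X
    equal to its square: either a whole row of X * X avoids the integers, or all
    the rows meet them, and at distinct integers. *)
Lemma embeds_nat_sum_absorb X S : embeds (X * X) X -> ~ embeds X nat ->
  embeds X (nat + S) -> embeds X S.
Proof.
move=> XX Xn /(embeds_trans XX)[f fI].
have [[r rS]|no] := pselect (exists r, forall x, exists s, f (r, x) = inr s).
  have [g gE] := choice rS; exists g => x y gxy.
  by have /fI[] : f (r, x) = f (r, y) by rewrite !gE gxy.
case: Xn; have row r : exists n, exists x, f (r, x) = inl n.
  apply: contrapT => rN; apply: no; exists r => x.
  by case E: (f (r, x)) => [n|s]; [case: rN; exists n, x|exists s].
have [g gE] := choice row; exists g => r s grs.
have [[x fx] [y fy]] := (gE r, gE s).
by have /fI[] : f (r, x) = f (s, y) by rewrite fx fy grs.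
Qed.

(** The outcome of one stage of the diagonalization against R.  Here Y is the set
    of points used so far and Z the set of points forbidden so far; the stage
    uses the point y and forbids the points of F.  By step_old, a set whose
    R-images must avoid forbidden points contains no point of Y with an unused
    image.  The flag al says that y will belong to every set of the family, and
    step_kill that it then has a forbidden image; without the flag, step_trivial
    says that the only free point with image y is y itself.  The bound step_few
    keeps the forbidden points few enough for the construction to go on. *)
Record good_step X (R : nat -> X -> X -> Prop) (Y Z : set X)
    (y : X) (al : bool) (F : set X) : Prop := GoodStep {
  step_fresh : [/\ ~ Y y, ~ Z y & ~ F y];
  step_forbid : forall z, F z -> ~ Y z;
  step_few : exists h : nat -> X -> X,
    forall z, F z -> exists k x, (Y x \/ x = y) /\ z = h k x;
  step_old : forall k x z, Y x -> R k x z -> ~ Y z -> exists2 z', F z' & R k x z';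
  step_kill : al -> exists k, exists2 z, F z & R k y z;
  step_trivial : ~~ al -> forall k x z, ~ Y x -> ~ Z x -> ~ F x -> R k x z ->
    Y z \/ z = x }.

(** First forbid one unused image, if there is any, of each used point.  If some
    free point then still has an unused image other than itself, use that point
    and forbid the image; otherwise any free point will do. *)
Lemma good_step_exists X (R : nat -> X -> X -> Prop) (Y Z : set X) :
  (forall h : nat -> X -> X, exists y,
     [/\ ~ Y y, ~ Z y & forall k x, Y x -> h k x <> y]) ->
  exists y al F, good_step R Y Z y al F.
Proof.
move=> room.
have [h hP] : exists h : nat -> X -> X, forall k x,
    (exists2 z, R k x z & ~ Y z) -> R k x (h k x) /\ ~ Y (h k x).
  have pick (p : nat * X) : exists z, (exists2 z, R p.1 p.2 z & ~ Y z) ->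
      R p.1 p.2 z /\ ~ Y z.
    by have [[z Rz Yz]|no] := pselect (exists2 z, R p.1 p.2 z & ~ Y z);
      [exists z|exists p.2].
  by have [h hP] := choice pick; exists (fun k x => h (k, x)) => k x; exact: (hP (k, x)).
pose F1 z := exists k x, [/\ Y x, (exists2 z, R k x z & ~ Y z) & z = h k x].
have F1Y z : F1 z -> ~ Y z by move=> [k [x [_ /hP[_ +] ->]]].
have F1old k x z : Y x -> R k x z -> ~ Y z -> exists2 z', F1 z' & R k x z'.
  move=> Yx Rz Yz; have ex : exists2 z, R k x z & ~ Y z by exists z.
  by exists (h k x); [exists k, x|case: (hP _ _ ex)].
have [[k [x [z [[Yx Zx Fx] Rz Yz zx]]]]|no] := pselect (exists k x z,
    [/\ [/\ ~ Y x, ~ Z x & ~ F1 x], R k x z, ~ Y z & z <> x]).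
- exists x, true, (fun t => F1 t \/ t = z); split => //.
  + by split => //; case => // xz; case: zx.
  + by move=> t [/F1Y //|->].
  + exists (fun k t => if pselect (t = x) then z else h k t) => t [].
      move=> [l [s [Ys _ ->]]]; exists l, s; split; first by left.
      by case: pselect => // sx; case: Yx; rewrite -sx.
    by move=> ->; exists k, x; split; [right|case: pselect].
  + by move=> l s t Ys Rt Yt; have [t' ? ?] := F1old _ _ _ Ys Rt Yt; exists t'; [left|].
  + by move=> _; exists k, z => //; right.
- have [y [Yy Zy hy]] := room h.
  exists y, false, F1; split => //.
  + by split => // -[k [x [Yx _ yh]]]; apply: hy Yx _; exact: esym yh.
  + by exists h => t [l [s [Ys _ ->]]]; exists l, s; split; [left|].
  + move=> _ k x z Yx Zx Fx Rz; apply: contrapT => /not_orP[Yz zx].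
    by apply: no; exists k, x, z.
Qed.

(** There is one stage for each point a, bit b and relation index i.  A point used
    with the flag goes to every M A, and one used without it at the stage
    (a, b, i) goes to those M A for which the truth value of A a is b.  If M A'
    were the union of the images of the M (A_ k) under D i, look at the stage
    (a, b, i) with b the truth value of A' a: with the flag, its point has a
    forbidden image; without the flag, its point is in M A' and in none of the
    M (A_ k), so it is not the image of a point of M (A_ k) under D i k. *)
Lemma diagonal_family (X I : Type) (q : nat -> X) (D : I -> nat -> X -> X -> Prop) :
  embeds (X * X) X -> embeds (X * bool * I) X -> ~ embeds X nat ->
  exists M : set X -> set X, (forall A n, M A (q n)) /\
    forall (A' : set X) (A_ : nat -> set X) a i,
      (forall k x y, D i k x y -> ~ (A_ k a <-> A' a)) ->
      ~ (forall y, M A' y <-> exists k x, M (A_ k) x /\ D i k x y).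
Proof.
move=> XX stageX Xn.
have [|W [lt [wf tri trans XW segX]]] := @minimal_type (embeds X) X _ (embeds_refl X).
  by move=> A B AB _ XA; exact: embeds_trans AB.
have [e eI] := embeds_trans stageX XW.
pose R w k x z := exists a b i, e (a, b, i) = w /\ D i k x z.
pose Y (f : W -> X * bool * set X) w : set X := fun x =>
  (exists n, q n = x) \/ exists2 u, lt u w & (f u).1.1 = x.
pose Z (f : W -> X * bool * set X) w : set X := fun x => exists2 u, lt u w & (f u).2 x.
have YE f g w : (forall u, lt u w -> f u = g u) -> Y f w = Y g w.
  move=> fg; apply/funext => x; apply/propext; split=> -[?|[u uw ux]]; try by left.
    by right; exists u; rewrite -?fg.
  by right; exists u; rewrite ?fg.
have ZE f g w : (forall u, lt u w -> f u = g u) -> Z f w = Z g w.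
  move=> fg; apply/funext => x; apply/propext; split=> -[u uw ux].
    by exists u; rewrite -?fg.
  by exists u; rewrite ?fg.
have [|||f fP] := @wf_rec_spec W (X * bool * set X)%type lt (q 0, true, set0)
  (fun w f v => good_step (R w) (Y f w) (Z f w) v.1.1 v.1.2 v.2).
- exact: wf.
- by move=> w f g v fg; rewrite (YE _ _ _ fg) (ZE _ _ _ fg).
- move=> w f fP.
  suff /(good_step_exists (R w))[y [al [F yF]]] : forall h : nat -> X -> X, exists y,
     [/\ ~ Y f w y, ~ Z f w y & forall k x, Y f w x -> h k x <> y].
    by exists (y, al, F).
  move=> h; apply: contrapT => no; apply: (segX w).
  (* The used and forbidden points are all indexed by triples of elements of
     nat + segment lt w, which are as few as its elements: some point is free. *)
  set T := (nat + segment lt w)%type.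
  have TT : embeds (T * T) T by exact: nat_sum_square.
  apply: (embeds_nat_sum_absorb XX Xn).
  apply: (@embeds_trans _ (T * (T * T))%type); last first.
    exact: embeds_trans (embeds_prod (embeds_refl T) TT) TT.
  have /choice[H HP] : forall u, exists hu : nat -> X -> X, lt u w ->
      forall z, (f u).2 z -> exists k x, (Y f u x \/ x = (f u).1.1) /\ z = hu k x.
    move=> u; have [uw|?] := pselect (lt u w); last by exists h.
    by have [hu huP] := step_few (fP u uw); exists hu.
  pose t (s : T) := match s with inl n => q n | inr u => (f (sval u)).1.1 end.
  have tY x : Y f w x -> exists s, t s = x.
    by move=> [[n <-]|[u uw <-]]; [exists (inl n)|exists (inr (exist _ u uw))].
  apply: (@embeds_surj _ _ (fun p => match p with
    | (inl 0, (_, s)) => t s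
    | (inl _, (inl k, s)) => h k (t s)
    | (inr u, (inl k, s)) => H (sval u) k (t s)
    | _ => q 0 end)) => y.
  apply: contrapT => yN; apply: no; exists y; split.
  + by move=> /tY[s sy]; apply: yN; exists (inl 0, (inl 0, s)).
  + move=> [u uw /(HP u uw)[k [x [xY yE]]]].
    have [s sx] : exists s, t s = x.
      apply: tY; case: xY => [[?|[v vu vx]]|->]; [by left| |].
        by right; exists v => //; exact: trans uw.
      by right; exists u.
    by apply: yN; exists (inr (exist _ u uw), (inl k, s)); rewrite /= sx.
  + by move=> k x /tY[s sx] hy; apply: yN; exists (inl 1, (inl k, s)); rewrite sx.
pose M (A : set X) : set X := fun x => (exists n, q n = x) \/
  exists w, x = (f w).1.1 /\ ((f w).1.2 \/
    exists a b i, e (a, b, i) = w /\ (A a <-> b)).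
(* No point is used and forbidden, whichever of the two comes first. *)
have MF A x w : M A x -> ~ (f w).2 x.
  have FY := step_forbid (fP w).
  move=> [[n nx]|[u [-> _]]] Fx; first by apply: FY Fx _; left; exists n.
  have [uw|[uw|wu]] := tri u w.
  - by apply: FY Fx _; right; exists u.
  - by move: Fx; rewrite uw; have [_ _] := step_fresh (fP w).
  - by have [_ + _] := step_fresh (fP u); apply; exists w.
exists M; split=> [A n|A' A_ a i AA' H]; first by left; exists n.
pose w := e (a, `[< A' a >], i).
have Rw k x z : R w k x z <-> D i k x z.
  split=> [[a1 [b1 [i1 [/eI[_ _ ->]]]]] //|Dz].
  by exists a, `[< A' a >], i.
have kill k x z : M (A_ k) x -> D i k x z -> ~ (f w).2 z.
  by move=> Mx Dz; apply: MF; apply/H; exists k, x.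
have [al|al] := boolP (f w).1.2.
  have [k [z Fz /Rw Dz]] := step_kill (fP w) al.
  by apply: kill Dz Fz; right; exists w; split => //; left.
have [Yy _ _] := step_fresh (fP w).
have : M A' (f w).1.1.
  right; exists w; split => //; right; exists a, `[< A' a >], i; split => //.
  by split=> /asboolP.
move=> /H[k [x [Mx Dx]]].
have [Yx|Yx] := pselect (Y f w x).
  have [z Fz /Rw Dz] := step_old (fP w) Yx (proj2 (Rw _ _ _) Dx) Yy.
  exact: kill Dz Fz.
have xZ : ~ Z f w x by move=> [u _]; exact: MF Mx.
have [//|wx] := step_trivial (fP w) al Yx xZ (MF _ _ _ Mx) (proj2 (Rw _ _ _) Dx).
case: Mx => [[n nx]|[u [xu lab]]]; first by apply: Yx; left; exists n.
have uw : u = w.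
  have [uw|[//|wu]] := tri u w.
    by case: Yx; right; exists u.
  by have [+ _ _] := step_fresh (fP u); case; right; exists w => //; rewrite wx.
case: lab; rewrite uw; first by apply/negP.
move=> [a1 [b1 [i1 [/eI[-> -> _] Aa]]]].
apply: (AA' _ _ _ Dx); rewrite Aa.
by split=> /asboolP.
Qed.

Local Open Scope ring_scope.
Local Open Scope card_scope.

(** * Closed embeddings induce Tukey morphisms *)

Lemma metrizable_balls (R : realType) (X : topologicalType) :
  metrizable R X -> exists d : X -> X -> R,
  [/\ forall x y, d x y = 0 <-> x = y,
      forall x y, d x y = d y x,
      forall x y z, d x z <= d x y + d y z,
      forall x e, open [set y | d x y < e] &
      forall x U, nbhs x U -> exists2 e, 0 < e & [set y | d x y < e] `<=` U].
Proof.
move=> [d [d0 dC dT dO]]; exists d; split => // [x e|x U].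
  apply/dO => y /= xy; exists (e - d x y); first by rewrite subr_gt0.
  by move=> z /= yz; apply: le_lt_trans (dT x y z) _; rewrite -ltrBrDl.
rewrite nbhsE => -[V [Vo Vx] VU].
have [e e0 eV] := proj1 (dO V) Vo x Vx.
by exists e => // y /eV /VU.
Qed.

Lemma metrizable_hausdorff (R : realType) (X : topologicalType) :
  metrizable R X -> hausdorff_space X.
Proof.
move=> /metrizable_balls[d [d0 dC dT ballo _]] p q pq; apply: contrapT => pNq.
have d_ge0 x y : 0 <= d x y.
  have := dT x y x; rewrite (proj2 (d0 x x) erefl) (dC y x) -mulr2n.
  by rewrite pmulrn_lge0.
have dgt0 : 0 < d p q.
  by rewrite lt_neqAle d_ge0 andbT eq_sym; apply/eqP => /d0.
have e0 : 0 < d p q / 2 by rewrite divr_gt0.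
have nball x : nbhs x [set y | d x y < d p q / 2].
  by apply: open_nbhs_nbhs; split; rewrite //= (proj2 (d0 x x) erefl).
have [z [/= pz qz]] := pq _ _ (nball p) (nball q).
have := le_lt_trans (dT p z q) (ltrD pz (_ : d z q < d p q / 2)).
by rewrite -splitr ltxx dC; move/(_ qz).
Qed.

(** In a Hausdorff space compact sets are closed, so that being closed in T and
    being closed in the whole space agree for subsets of T. *)
Lemma kspace_relE (X : topologicalType) (S T : set X) :
  hausdorff_space X -> compact T ->
  closed (S `&` T : set (subspace T)) <-> closed (S `&` T).
Proof.
move=> hX cT; have Tc := compact_closed hX cT.
by rewrite -(closed_setIS _ Tc) -setIA setIid.
Qed.

(** The morphism takes direct images of non-closed sets and inverse images of
    compact sets.  The range of f must be closed: this makes inverse images of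
    compact sets compact and closed sets have closed images. *)
Lemma kspace_closed_embedding (X Y : topologicalType) (f : X -> Y) :
  hausdorff_space X -> hausdorff_space Y -> injective f ->
  (forall x B, nbhs x B <-> exists2 V, nbhs (f x) V & f @^-1` V `<=` B) ->
  closed (range f) ->
  tukey_ge (kspace Y) (kspace X).
Proof.
move=> hX hY fI fN fR.
(* Along f, a set is closed exactly when its image is. *)
have fclosed A : closed (f @` A) -> closed A.
  move=> cfA x xA; have [a Aa /fI <- //] : (f @` A) (f x).
    apply: cfA => V nV; have [|z [Az Vz]] := xA (f @^-1` V).
      by apply/fN; exists V.
    by exists (f z); split => //; exists z.
have closedf A : closed A -> closed (f @` A).
  move=> cA y yA; have [|x _ xy] := fR y.
    by move=> V /yA[_ [[a _ <-] Va]]; exists (f a); split => //; exists a.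
  exists x => //; apply: cA => B /fN[V nV VB].
  move: nV; rewrite xy => /yA[_ [[a Aa <-] Va]].
  by exists a; split => //; apply: VB.
have cpt K : compact K -> compact (f @^-1` K).
  move=> cK F FF FK; have [p [Kp Fp]] := cK (f @ F) _ FK.
  have [|x _ xp] := fR p.
    move=> V nV; have [|y [yf Vy]] := Fp (range f) V _ nV; last by exists y.
    have FR : F (f @^-1` range f) by apply: filterS filterT => z _; exists z.
    exact: FR.
  exists x; split; first by rewrite /= xp.
  move=> A B FA /fN[V nV VB]; rewrite xp in nV.
  have [|_ [[a Aa <-] Va]] := Fp (f @` A) V _ nV.
    have FfA : F (f @^-1` (f @` A)) by apply: filterS FA => z Az; exists z.
    exact: FfA.
  by exists a; split => //; apply: VB.
have psiP (S : {S : set X | ~ closed S}) : ~ closed (f @` sval S).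
  by move/fclosed; exact: svalP S.
exists (fun S => exist (fun S => ~ closed S) _ (psiP S)).
exists (fun K => exist (fun K => compact K) _ (cpt _ (svalP K))).
move=> S K /= SK; apply: contra_not SK.
move=> /(kspace_relE _ hX (cpt _ (svalP K))) SK.
apply/(kspace_relE _ hY (svalP K)).
rewrite (_ : _ `&` _ = f @` (sval S `&` f @^-1` sval K)); first exact: closedf.
apply/seteqP; split=> [_ [[x Sx <-] Kx]|_ [x [Sx Kx] <-]]; first by exists x.
by split => //; exists x.
Qed.

(** * Subspaces of the Cantor space *)

Definition agree (n : nat) (x y : nat -> bool) : Prop :=
  forall i, (i < n)%N -> x i = y i.

Lemma agree_sym n x y : agree n x y -> agree n y x.
Proof. by move=> xy i /xy. Qed.

Lemma agree_trans n x y z : agree n x y -> agree n y z -> agree n x z.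
Proof. by move=> xy yz i ni; rewrite xy // yz. Qed.

Lemma agree_le m n x y : (m <= n)%N -> agree n x y -> agree m x y.
Proof. by move=> mn xy i im; apply: xy; exact: leq_trans mn. Qed.

Lemma agree_eq x y : (forall n, agree n x y) -> x = y.
Proof. by move=> xy; apply/funext => n; exact: (xy n.+1). Qed.

(** A named copy of the subtype, carrying the topology generated by finite
    prefixes. *)
Definition csub (E : set (nat -> bool)) : Type := {x | E x}.

HB.instance Definition _ (E : set (nat -> bool)) := gen_eqMixin (csub E).
HB.instance Definition _ (E : set (nat -> bool)) := gen_choiceMixin (csub E).

Section csub_topology.
Variable E : set (nat -> bool).

Definition csub_open (U : set (csub E)) : Prop :=
  forall x, U x -> exists n, forall y : csub E, agree n (sval x) (sval y) -> U y.

Lemma csub_openT : csub_open setT.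
Proof. by move=> x _; exists 0%N. Qed.

Lemma csub_openI : setI_closed csub_open.
Proof.
move=> U V Uo Vo x [/Uo[m mU] /Vo[n nV]]; exists (maxn m n) => y xy.
by split; [apply: mU|apply: nV]; apply: agree_le xy; rewrite ?leq_maxl ?leq_maxr.
Qed.

Lemma csub_open_bigcup (I : Type) (f : I -> set (csub E)) :
  (forall i, csub_open (f i)) -> csub_open (\bigcup_i f i).
Proof.
by move=> fo x [i _ /fo[n nf]]; exists n => y /nf fy; exists i.
Qed.

HB.instance Definition _ := isOpenTopological.Build (csub E)
  csub_openT csub_openI csub_open_bigcup.

Lemma csub_openE (U : set (csub E)) : open U <-> csub_open U.
Proof.
rewrite openE; split=> [Uo x /Uo[V [Vo Vx VU]]|Uo x Ux].
  by have [n nV] := Vo x Vx; exists n => y /nV /VU.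
by exists U; split.
Qed.

Lemma csub_nbhsE (x : csub E) (U : set (csub E)) :
  nbhs x U <-> exists n, forall y : csub E, agree n (sval x) (sval y) -> U y.
Proof.
split=> [[V [Vo Vx VU]]|[n nU]].
  by have [n nV] := Vo x Vx; exists n => y /nV /VU.
exists [set y : csub E | agree n (sval x) (sval y)]; split => //.
by move=> y /= xy; exists n => z yz; exact: agree_trans yz.
Qed.

Lemma csub_nbhs n (x : csub E) : nbhs x [set y : csub E | agree n (sval x) (sval y)].
Proof. by apply/csub_nbhsE; exists n. Qed.

End csub_topology.

Section csub_metric.
Variables (R : realType) (E : set (nat -> bool)).

Lemma neq_first_difference (x y : nat -> bool) : x <> y -> exists n, x n != y n.
Proof.
move=> xy; apply: contrapT => no; apply: xy; apply/funext => n.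
by apply/eqP; apply: contrapT => xy; apply: no; exists n; apply/negP.
Qed.

(** The usual ultrametric: the inverse of the rank, counted from 1, of the
    first disagreement. *)
Definition cdist (x y : nat -> bool) : R :=
  match pselect (x = y) with
  | left _ => 0
  | right xy => (ex_minn (neq_first_difference xy)).+1%:R^-1
  end.

Lemma cdist_lt n x y : cdist x y < n.+1%:R^-1 <-> agree n.+1 x y.
Proof.
rewrite /cdist; case: pselect => [->|xy].
  by split=> // _; rewrite invr_gt0 ltr0n.
case: ex_minnP => m xm mmin; rewrite ltf_pV2 ?posrE ?ltr0n // ltr_nat ltnS.
split=> [nm i ni|xyn].
  apply/eqP; apply: contraTT ni => /mmin mi; rewrite -leqNgt.
  exact: leq_trans mi.
by rewrite ltnNge; apply/negP => mn; move: xm; rewrite xyn ?eqxx // ltnS.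
Qed.

Lemma cdist_ge0 x y : 0 <= cdist x y.
Proof. by rewrite /cdist; case: pselect => // ?; rewrite invr_ge0. Qed.

Lemma cdist_form x y : x <> y -> exists n, cdist x y = n.+1%:R^-1.
Proof. by move=> xy; rewrite /cdist; case: pselect => // ?; eexists. Qed.

Lemma csub_metrizable : metrizable R (csub E).
Proof.
exists (fun x y => cdist (sval x) (sval y)).
have dE x y : cdist x y = 0 <-> x = y.
  split=> [xy|->]; last by rewrite /cdist; case: pselect.
  apply: agree_eq => n; apply: (@agree_le _ n.+1) => //; apply/cdist_lt.
  by rewrite xy invr_gt0 ltr0n.
have dC x y : cdist x y = cdist y x.
  have le u v : cdist u v <= cdist v u.
    have [->//|uv] := pselect (u = v).
    have [n vu] := @cdist_form v u (nesym uv); have [m uvm] := cdist_form uv.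
    rewrite leNgt uvm; apply/negP => /cdist_lt /agree_sym /cdist_lt.
    by rewrite uvm ltxx.
  by apply/eqP; rewrite eq_le !le.
split.
- by move=> x y; rewrite dE; split=> [|->//]; exact: sval_inj.
- by move=> x y; exact: dC.
- move=> [x ?] [y ?] [z ?] /=.
  have [->|xz] := pselect (x = z).
    by rewrite (proj2 (dE z z) erefl) addr_ge0 ?cdist_ge0.
  have [n xzE] := cdist_form xz; rewrite leNgt; apply/negP => lt.
  have xy : cdist x y < n.+1%:R^-1.
    by rewrite -xzE; apply: le_lt_trans lt; rewrite lerDl cdist_ge0.
  have yz : cdist y z < n.+1%:R^-1.
    by rewrite -xzE; apply: le_lt_trans lt; rewrite lerDr cdist_ge0.
  have : cdist x z < n.+1%:R^-1.
    apply/cdist_lt; exact: agree_trans (proj1 (cdist_lt _ _ _) xy) (proj1 (cdist_lt _ _ _) yz).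
  by rewrite xzE ltxx.
- move=> U; rewrite csub_openE; split=> [Uo x /Uo[n nU]|Uo x /Uo[e e0 eU]].
    exists n.+1%:R^-1; first by rewrite invr_gt0 ltr0n.
    by move=> y /= /cdist_lt xy; apply: nU; apply: agree_le xy.
  exists (Num.truncn e^-1).+1 => y xy; apply: eU => /=.
  have /lt_trans -> // : cdist (sval x) (sval y) < (Num.truncn e^-1).+1%:R^-1.
    exact/cdist_lt.
  by rewrite invf_plt ?posrE ?ltr0n // truncnS_gt.
Qed.

Definition initseg (n : nat) (x : nat -> bool) : seq bool := mkseq x n.

Lemma initsegP n x y : initseg n x = initseg n y <-> agree n x y.
Proof.
split=> [xy i ni|xy].
  by move/(congr1 (nth false ^~ i)): xy; rewrite !nth_mkseq.
apply: (@eq_from_nth _ false); rewrite ?size_mkseq // => i ni.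
by rewrite !nth_mkseq // xy.
Qed.

Lemma csub_separable : separable_space (csub E).
Proof.
have [[x0 Ex0]|E0] := pselect (exists x, E x); last first.
  exists set0; split; first exact: countable0.
  by move=> O [[x Ex]]; case: E0; exists x.
have /choice[f fP] : forall s : seq bool, exists x : csub E,
    forall y : csub E, initseg (size s) (sval y) = s -> initseg (size s) (sval x) = s.
  move=> s; have [[y ys]|no] := pselect (exists y : csub E, initseg (size s) (sval y) = s).
    by exists y.
  by exists (exist _ x0 Ex0) => y ys; case: no; exists y.
exists (range f); split.
  by apply: card_le_trans (card_image_le _ _) _; exact: countableP.
move=> O [x Ox] /csub_openE /(_ x Ox)[n nO].
exists (f (initseg n (sval x))); split; last by exists (initseg n (sval x)).
apply: nO; apply/initsegP.
have := fP (initseg n (sval x)) x.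
by rewrite size_mkseq => ->.
Qed.

Definition csub_space : sepMetrizable R := SepMetrizable csub_separable csub_metrizable.

End csub_metric.

Lemma csub_hausdorff E : hausdorff_space (csub E).
Proof.
move=> x y xy; apply: sval_inj; apply: agree_eq => n.
have [z [xz yz]] := xy _ _ (csub_nbhs n x) (csub_nbhs n y).
exact: agree_trans xz (agree_sym yz).
Qed.

(** * The closed relation underlying a Tukey morphism *)

(** Compactness of a set that converges to one of its points: what lies outside
    any neighborhood of p is controlled by a compact set.  Applied twice, it
    shows that a convergent sequence of convergent sequences is compact. *)
Lemma compact_converging (X : topologicalType) (p : X) (K : set X) :
  K p ->
  (forall U, nbhs p U -> exists L, [/\ compact L, L `<=` K & K `<=` U `|` L]) ->
  compact K.
Proof.
move=> Kp Kacc F FF FK; have [Fp|] := pselect (cluster F p); first by exists p.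
move=> NFp.
have [A [U [FA pU AU]]] : exists A U, [/\ F A, nbhs p U & A `&` U = set0].
  apply: contrapT => no; apply: NFp => A U FA pU.
  by apply/set0P/eqP => AU; apply: no; exists A, U.
have [L [cL LK KU]] := Kacc U pU.
have [|x [Lx Fx]] := cL F FF; last by exists x; split => //; exact: LK.
apply: filterS (filterI FK FA) => x [Kx Ax]; have [Ux|//] := KU x Kx.
by have : (A `&` U) x by []; rewrite AU.
Qed.

(** The relations prefix_rel c are the closed relations on the Cantor space, each
    coded by a set of pairs of finite words. *)
Definition prefix_rel (c : set (seq bool * seq bool)) (x y : nat -> bool) : Prop :=
  forall n, c (initseg n x, initseg n y).

(** The complement of a point x of F is not closed; g x is a witness that its
    image by psi is not closed either, and c codes the closure of the set of
    pairs (g x, x).  A pair (m, y) of that closure, with m in E, is a limit of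
    pairs (g (u n), u n).  The compact set K is made of m, the points g (u n) and
    sequences p n of psi (complement of u n) tending to g (u n).  As K sees that
    this set is not closed, u n is in phi K; by compactness of phi K the limit y
    is in F. *)
Lemma tukey_ge_prefix_rel (E F : set (nat -> bool)) :
  (forall y, F y -> forall n, exists z, [/\ F z, agree n y z & z <> y]) ->
  tukey_ge (kspace (csub E)) (kspace (csub F)) ->
  exists c, forall y, F y <-> exists2 x, E x & prefix_rel c x y.
Proof.
move=> crowded [psi [phi psiphi]].
have Sncl (x : csub F) : ~ closed (~` [set x]).
  move=> cl; suff : (~` [set x]) x by apply.
  apply: cl => B /csub_nbhsE[n nB].
  have [z [Fz xz zx]] := crowded _ (svalP x) n.
  exists (exist _ z Fz); split; last exact: nB.
  by move=> /(congr1 sval).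
pose S x : {S : set (csub F) | ~ closed S} :=
  exist (fun S => ~ closed S) _ (Sncl x).
pose P x := sval (psi (S x)).
have /choice[g gP] : forall x, exists m, closure (P x) m /\ ~ P x m.
  move=> x; apply: contrapT => no; apply: (svalP (psi (S x))) => m Pm.
  by apply: contrapT => NPm; apply: no; exists m.
pose c : set (seq bool * seq bool) := fun s => exists n x,
  s = (initseg n (sval (g x)), initseg n (sval x)).
exists c => y; split=> [Fy|[m Em cmy]].
  exists (sval (g (exist _ y Fy))); first exact: svalP (g _).
  by move=> n; exists n, (exist _ y Fy).
have /choice[u uP] : forall n, exists x : csub F,
    agree n m (sval (g x)) /\ agree n y (sval x).
  move=> n; have [k [x [mx yx]]] := cmy n; exists x.
  have kn : k = n by move: mx => /(congr1 size); rewrite !size_mkseq.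
  by rewrite kn in mx yx; split; apply/initsegP.
have [p pP] : exists p : nat -> nat -> csub E, forall n i,
    P (u n) (p n i) /\ agree (n + i) (sval (g (u n))) (sval (p n i)).
  have pex (ni : nat * nat) : exists q : csub E, P (u ni.1) q /\
      agree (ni.1 + ni.2) (sval (g (u ni.1))) (sval q).
    have [cl _] := gP (u ni.1).
    by have [q [Pq Aq]] := cl _ (csub_nbhs (ni.1 + ni.2) _); exists q.
  by have [p pP] := choice pex; exists (fun n i => p (n, i)) => n i; exact: (pP (n, i)).
(* The choice of agree (n + i) makes p n converge to g (u n), and makes the whole
   set Kn n lie within the n-th neighborhood of g (u n). *)
pose Kn n := [set g (u n)] `|` range (p n).
have Kn_compact n : compact (Kn n).
  apply: (@compact_converging _ (g (u n))); first by left.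
  move=> U /csub_nbhsE[k kU]; exists (p n @` `I_k); split.
  - by apply: finite_compact; apply: finite_image; exact: finite_II.
  - by move=> _ [i _ <-]; right; exists i.
  - move=> _ [->|[i _ <-]]; first by left; exact: kU.
    have [ik|ki] := ltnP i k; first by right; exists i.
    left; apply: kU; apply: agree_le (pP n i).2.
    exact: leq_trans ki (leq_addl _ _).
pose M : csub E := exist _ m Em.
pose K := [set M] `|` \bigcup_n Kn n.
have K_compact : compact K.
  apply: (@compact_converging _ M); first by left.
  move=> U /csub_nbhsE[k kU]; exists (\bigcup_(n < k) Kn n); split.
  - by rewrite bigcup_mkord; apply: bigsetU_compact => i _; exact: Kn_compact.
  - by move=> x [n _ Knx]; right; exists n.
  - move=> x [->|[n _ Knx]]; first by left; exact: kU.
    have [nk|kn] := ltnP n k; first by right; exists n.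
    left; apply: kU => /=; apply: agree_le kn _.
    have [mu _] := uP n; apply: agree_trans mu _.
    case: Knx => [->//|[i _ <-]]; apply: agree_le (pP n i).2.
    exact: leq_addr.
pose L := phi (exist (fun K => compact K) K K_compact).
have Lu n : sval L (u n).
  apply: contrapT => NLu.
  have : @rel_holds (kspace (csub F)) (S (u n)) L.
    apply: psiphi => /= cl.
    have {}cl := proj1 (kspace_relE _ (@csub_hausdorff E) K_compact) cl.
    have [gcl] := gP (u n); apply.
    suff [] : (P (u n) `&` K) (g (u n)) by [].
    apply: cl => B /csub_nbhsE[k kB]; exists (p n k); split.
      split; first exact: (pP n k).1.
      by right; exists n => //; right; exists k.
    by apply: kB; apply: agree_le (pP n k).2; exact: leq_addl.
  apply => /=; apply/(kspace_relE _ (@csub_hausdorff F) (svalP L)).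
  rewrite (_ : _ `&` _ = sval L); first exact: compact_closed (@csub_hausdorff F) (svalP L).
  by apply/seteqP; split=> [x []//|x Lx]; split => //= xu; apply: NLu; rewrite -xu.
have [|x [Lx clx]] := svalP L (u @ \oo) _.
  by exists 0%N => // n _; exact: Lu.
suff -> : y = sval x by exact: svalP x.
apply: agree_eq => n.
have Fu : (u @ \oo) (u @` [set k | (n <= k)%N]).
  by exists n => // k nk; exists k.
have [_ [[k nk <-] xk]] := clx _ _ Fu (csub_nbhs n x).
apply: agree_trans (agree_sym xk).
by have [_ yu] := uP k; exact: agree_le yu.
Qed.

Lemma csub_closed_embedding (E F : set (nat -> bool)) (f : (nat -> bool) -> nat -> bool) :
  (forall x, F x -> E (f x)) ->
  (forall n, exists k, forall x y, agree k x y -> agree n (f x) (f y)) ->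
  (forall n, exists k, forall x y, agree k (f x) (f y) -> agree n x y) ->
  (forall z, E z -> (forall n, exists2 x, F x & agree n z (f x)) ->
    exists2 x, F x & z = f x) ->
  tukey_ge (kspace (csub E)) (kspace (csub F)).
Proof.
move=> FE fc fo fcl.
pose h (x : csub F) : csub E := exist _ (f (sval x)) (FE _ (svalP x)).
apply: (kspace_closed_embedding (f := h)); try exact: csub_hausdorff.
- move=> x y /(congr1 sval) /= xy; apply: sval_inj; apply: agree_eq => n.
  by have [k kP] := fo n; apply: kP; rewrite xy.
- move=> x B; split=> [/csub_nbhsE[n nB]|[V /csub_nbhsE[n nV] VB]].
    have [k kP] := fo n; exists [set z : csub E | agree k (f (sval x)) (sval z)].
      exact: csub_nbhs.
    by move=> y /= /kP; exact: nB.
  have [k kP] := fc n; apply/csub_nbhsE; exists k => y /kP xy.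
  by apply: VB; exact: nV.
- move=> z clz; have [|x Fx zx] := fcl _ (svalP z).
    move=> n; have [_ [[x _ <-] zx]] := clz _ (csub_nbhs n z).
    by exists (sval x) => //; exact: svalP x.
  by exists (exist _ x Fx) => //; apply: sval_inj.
Qed.

(** * Gluing spaces along the Cantor space *)

Definition interleave (r x : nat -> bool) : nat -> bool :=
  fun i => if odd i then x i./2 else r i./2.

Lemma agree_interleave n r x s y :
  agree n.*2 (interleave r x) (interleave s y) <-> agree n r s /\ agree n x y.
Proof.
split=> [rxsy|[rs xy] i ni]; last first.
  by rewrite /interleave; case: odd; rewrite ?rs ?xy // ltn_half_double.
split=> i ni.
  by have := rxsy i.*2; rewrite /interleave odd_double doubleK ltn_double; apply.
have := rxsy i.*2.+1; rewrite /interleave /= odd_double /= uphalf_double; apply.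
by rewrite ltn_Sdouble.
Qed.

Lemma interleave_inj r x s y : interleave r x = interleave s y -> r = s /\ x = y.
Proof.
move=> e; split; apply: agree_eq => n.
  by have [] := proj1 (agree_interleave n r x s y) (fun i _ => congr1 (@^~ i) e).
by have [] := proj1 (agree_interleave n r x s y) (fun i _ => congr1 (@^~ i) e).
Qed.

(** The union over r in T of the copies {r} * X r, in the square of the Cantor
    space read as the Cantor space itself.  For a relatively discrete T this is a
    topological disjoint sum. *)
Definition gather (T : set (nat -> bool)) (X : (nat -> bool) -> set (nat -> bool)) :
    set (nat -> bool) :=
  [set z | exists r x, [/\ T r, X r x & z = interleave r x]].

(** A fiber is closed because r is determined by the even coordinates. *)
Lemma gather_fiber T X r : T r ->
  tukey_ge (kspace (csub (gather T X))) (kspace (csub (X r))).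
Proof.
move=> Tr; apply: (csub_closed_embedding (f := interleave r)).
- by move=> x Xx; exists r, x.
- move=> n; exists n => x y xy.
  have : agree n.*2 (interleave r x) (interleave r y) by apply/agree_interleave.
  by apply: agree_le; rewrite -addnn leq_addr.
- by move=> n; exists n.*2 => x y /agree_interleave[].
- move=> z [s [x [Ts Xx ->]]] appr; suff rs : s = r by exists x; rewrite -?rs.
  by apply: agree_eq => n; have [y _ /agree_interleave[]] := appr n.*2.
Qed.

(** The hypothesis says that T is closed in T'. *)
Lemma gather_mono T T' X : T `<=` T' ->
  (forall s, T' s -> ~ T s -> exists n, forall r, T r -> ~ agree n s r) ->
  tukey_ge (kspace (csub (gather T' X))) (kspace (csub (gather T X))).
Proof.
move=> TT' cl; apply: (csub_closed_embedding (f := id)).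
- by move=> _ [r [x [Tr Xx ->]]]; exists r, x; split => //; exact: TT'.
- by move=> n; exists n.
- by move=> n; exists n.
- move=> _ [s [x [Ts Xx ->]]] appr; exists (interleave s x) => //.
  exists s, x; split => //; apply: contrapT => NTs.
  have [n nP] := cl _ Ts NTs.
  have [_ [r [y [Tr Xy ->]]] /agree_interleave[sr _]] := appr n.*2.
  exact: nP sr.
Qed.

(** * The cardinality of the continuum *)

Lemma embeds_card A B : embeds A B <-> [set: A] #<= [set: B].
Proof.
split=> [[f fI]|/card_leP[f]].
  by rewrite -(card_le_eql (inj_card_eq (f := f) (in2W fI))); exact: subset_card_le.
pose g (a : A) : B := val (f (SigSub (mem_set (I : [set: A] a)))).
exists g => a b /val_inj fab.
have /(congr1 val) : SigSub (mem_set (I : [set: A] a)) =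
    SigSub (mem_set (I : [set: A] b)) :> [set: A].
  by apply: ('inj_f) => //; rewrite inE.
by [].
Qed.

Lemma powerset_not_embeds A : ~ embeds (set A) A.
Proof. by move=> /embeds_card; exact: card_le_setN. Qed.

Lemma embeds_countable_powerset (T : countType) : embeds (set T) (nat -> bool).
Proof.
pose c (A : set T) n := `[< exists2 x, A x & pickle x = n >].
have sub A B : c A = c B -> A `<=` B.
  move=> AB x Ax; have : c A (pickle x) by apply/asboolP; exists x.
  by rewrite AB => /asboolP[y By /(pcan_inj pickleK) <-].
by exists c => A B AB; apply/seteqP; split; apply: sub.
Qed.

Lemma cantor_square_embeds : embeds ((nat -> bool) * (nat -> bool)) (nat -> bool).
Proof.
exists (fun p => interleave p.1 p.2) => -[r x] [s y] /= /interleave_inj[-> ->].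
by [].
Qed.

Lemma cantor_not_countable : ~ embeds (nat -> bool) nat.
Proof.
move=> h; apply: (@powerset_not_embeds nat).
exact: embeds_trans (@embeds_countable_powerset nat) h.
Qed.

(** Dedekind cuts. *)
Lemma real_embeds_cantor (R : realType) : embeds R (nat -> bool).
Proof.
apply: embeds_trans (@embeds_countable_powerset rat).
exists (fun x => [set q | ratr q < x]) => x y xy.
have le (u v : R) : [set q | ratr q < u] = [set q | ratr q < v] -> u <= v.
  move=> uv; rewrite leNgt; apply/negP => vu.
  have [q] := rat_in_itvoo vu; rewrite in_itv /= => /andP[vq qu].
  have : [set q | ratr q < u] q by [].
  by rewrite uv /= => /(lt_trans vq); rewrite ltxx.
by apply/eqP; rewrite eq_le !le.
Qed.

Section cantor_to_real.
Variable R : realType.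

(** Digits 0 and 1 in base 3: the tail after the digit n is worth at most half
    of what the digit n is worth, so that distinct sequences have distinct sums. *)
Definition ternary_sum (x : nat -> bool) (n : nat) : R :=
  \sum_(i < n) (x i)%:R * 3^-1 ^+ i.

(** The added term is the sum of all the powers of 1/3 from the given one on: it
    bounds what the remaining digits can contribute. *)
Lemma ternary_sum_tail x n m :
  ternary_sum x (n + m) + 2^-1 * 3 * 3^-1 ^+ (n + m) <=
  ternary_sum x n + 2^-1 * 3 * 3^-1 ^+ n.
Proof.
elim: m => [|m IH]; first by rewrite addn0.
apply: le_trans IH; rewrite addnS /ternary_sum big_ord_recr /= -addrA lerD2l exprS.
have : 0 <= 3^-1 ^+ (n + m) :> R by rewrite exprn_ge0 // invr_ge0.
by move: (3^-1 ^+ (n + m)) => t t0; case: (x (n + m)%N); rewrite ?mul1r ?mul0r; lra.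
Qed.

Lemma ternary_sum_le x n m : ternary_sum x n <= ternary_sum x (n + m).
Proof.
elim: m => [|m IH]; first by rewrite addn0.
apply: le_trans IH _; rewrite addnS /ternary_sum big_ord_recr /= lerDl.
by rewrite mulr_ge0 // exprn_ge0 // invr_ge0.
Qed.

Lemma cantor_embeds_real : embeds (nat -> bool) R.
Proof.
pose f x := sup (range (ternary_sum x)).
have ub x n : ubound (range (ternary_sum x)) (ternary_sum x n + 2^-1 * 3 * 3^-1 ^+ n).
  move=> _ [m _ <-]; apply: (@le_trans _ _ (ternary_sum x (n + m))).
    by rewrite addnC ternary_sum_le.
  apply: le_trans (ternary_sum_tail x n m); rewrite lerDl.
  by rewrite mulr_ge0 // exprn_ge0 // invr_ge0.
have hs x : has_sup (range (ternary_sum x)).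
  by split; [exists (ternary_sum x 0), 0%N|exists (ternary_sum x 0 + 2^-1 * 3 * 3^-1 ^+ 0)].
have fle x n : f x <= ternary_sum x n + 2^-1 * 3 * 3^-1 ^+ n.
  by apply: ge_sup (ub x n); case: (hs x).
have fge x n : ternary_sum x n <= f x.
  by apply: ub_le_sup; [case: (hs x)|exists n].
(* The first disagreement decides the order of the sums. *)
have sep x y n : agree n x y -> ~~ x n -> y n -> f x < f y.
  move=> xy xn yn; apply: le_lt_trans (fle x n.+1) _.
  apply: lt_le_trans (fge y n.+1); rewrite /ternary_sum !big_ord_recr /=.
  have -> : \sum_(i < n) (x i)%:R * 3^-1 ^+ i = \sum_(i < n) (y i)%:R * 3^-1 ^+ i :> R.
    by apply: eq_bigr => i _; rewrite xy.
  rewrite (negbTE xn) yn mul0r mul1r addr0 ltrD2l exprS.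
  have : 0 < 3^-1 ^+ n :> R by rewrite exprn_gt0 // invr_gt0.
  lra.
exists f => x y fxy; apply: contrapT => xNy.
have ex := neq_first_difference xNy; case: (ex_minnP ex) => n xn nmin.
have xy : agree n x y.
  move=> i ni; apply/eqP; apply: contraTT ni => /nmin; by rewrite -leqNgt.
move: xn; case xE : (x n); case yE : (y n) => // _.
  have := sep y x n (agree_sym xy); rewrite xE yE fxy ltxx => /(_ erefl erefl).
  by [].
by have := sep x y n xy; rewrite xE yE fxy ltxx => /(_ erefl erefl).
Qed.

End cantor_to_real.

(** * An independent family of subspaces of the Cantor space *)

Definition tukey_space_ge (E F : set (nat -> bool)) : Prop :=
  tukey_ge (kspace (csub E)) (kspace (csub F)).

Lemma tukey_space_ge_trans E F G :
  tukey_space_ge E F -> tukey_space_ge F G -> tukey_space_ge E G.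
Proof. exact: tukey_ge_trans. Qed.

(** Indices for countable sums: the spikes form a relatively discrete set, all
    of whose subsets are thus relatively closed. *)
Definition spike (k : nat) : nat -> bool := fun i => i == k.

Lemma agree_spike k l : agree k.+1 (spike k) (spike l) -> k = l.
Proof. by move=> /(_ k (ltnSn k)); rewrite /spike eqxx => /esym/eqP. Qed.

Lemma spike_inj : injective spike.
Proof. by move=> k l kl; apply: agree_spike; rewrite kl. Qed.

(** An enumeration of a countable dense set; containing it makes a subset of the
    Cantor space crowded. *)
Definition eventually_false (n : nat) : nat -> bool :=
  if unpickle n is Some s then nth false s else fun=> false.

Definition crowded (E : set (nat -> bool)) : Prop :=
  forall y, E y -> forall n, exists z, [/\ E z, agree n y z & z <> y].

(** Asking for one point a that separates A' from all the indices at once is what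
    lets a single stage of the diagonalization deal with the whole sum. *)
Definition independent (M : set (nat -> bool) -> set (nat -> bool)) : Prop :=
  forall (A' : set (nat -> bool)) (A : (nat -> bool) -> set (nat -> bool))
      (B : set nat) a,
    (forall k, B k -> ~ (A (spike k) a <-> A' a)) ->
    ~ tukey_space_ge (gather (spike @` B) (M \o A)) (M A').

(** The relations to diagonalize against are indexed by a code c of a closed
    relation and a set B of summands: there are continuum many of them. *)
Lemma independent_family : exists M : set (nat -> bool) -> set (nat -> bool),
  (forall A, crowded (M A)) /\ independent M.
Proof.
pose I := (set (seq bool * seq bool) * set nat)%type.
pose D (i : I) k x y := i.2 k /\ prefix_rel i.1 (interleave (spike k) x) y.
have stage : embeds ((nat -> bool) * bool * I) (nat -> bool).
  have CC := cantor_square_embeds.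
  have prod U V : embeds U (nat -> bool) -> embeds V (nat -> bool) ->
      embeds (U * V) (nat -> bool).
    by move=> U_C V_C; exact: embeds_trans (embeds_prod U_C V_C) CC.
  apply: (prod _ I); [apply: prod|apply: (prod (set _) (set _))].
  - exact: embeds_refl.
  - by exists (fun b _ => b) => b b' /(congr1 (@^~ 0%N)).
  - exact: embeds_countable_powerset.
  - exact: embeds_countable_powerset.
have [M [Mq MP]] := diagonal_family eventually_false D cantor_square_embeds stage
  cantor_not_countable.
have Mcr A : crowded (M A).
  move=> y My n.
  (* Flip the n-th coordinate of y and continue with false. *)
  pose s := rcons (initseg n y) (~~ y n).
  have sE i : eventually_false (pickle s) i = nth false s i.
    by rewrite /eventually_false pickleK.
  exists (eventually_false (pickle s)); split; first exact: Mq.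
    by move=> i ni; rewrite sE nth_rcons size_mkseq ni nth_mkseq.
  move=> /(congr1 (@^~ n)); rewrite sE nth_rcons size_mkseq ltnn eqxx.
  by case: (y n).
exists M; split=> // A' A B a AA' ge.
have [c cP] := tukey_ge_prefix_rel (Mcr A') ge.
apply: (MP A' (fun k => A (spike k)) a (c, B)).
  by move=> k x y [Bk _]; exact: AA'.
move=> y; rewrite cP; split=> [[_ [_ [x [[k Bk <-] Mx ->]]] cxy]|[k [x [Mx [Bk cxy]]]]].
  by exists k, x.
by exists (interleave (spike k) x) => //; exists (spike k), x; split => //; exists k.
Qed.

Section independent_families.
Variable M : set (nat -> bool) -> set (nat -> bool).
Hypotheses (M_crowded : forall A, crowded (M A)) (M_indep : independent M).

Lemma independent_antichain A A' : A <> A' -> ~ tukey_space_ge (M A) (M A').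
Proof.
move=> AA' ge.
have [a aP] : exists a, ~ (A a <-> A' a).
  apply: contrapT => no; apply: AA'; apply/funext => a; apply/propext.
  by apply: contrapT => aP; apply: no; exists a.
apply: (M_indep (A := fun=> A) (B := [set 0%N]) (fun _ _ => aP)).
apply: tukey_space_ge_trans ge.
by apply: (@gather_fiber _ (M \o fun=> A) (spike 0)); exists 0%N.
Qed.

Lemma independent_inj : injective M.
Proof.
move=> A A' MAA'; apply: contrapT => /independent_antichain; apply; rewrite MAA'.
exact: tukey_ge_refl.
Qed.

(** If every M A were below E, then A would be determined by a code of a closed
    relation mapping E onto M A; but the power set of the Cantor space does not
    embed in the Cantor space. *)
Lemma not_upper_bound E : exists A, ~ tukey_space_ge E (M A).
Proof.
apply: contrapT => no.
have /choice[c cP] : forall A, exists c, forall y,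
    M A y <-> exists2 x, E x & prefix_rel c x y.
  move=> A; apply: tukey_ge_prefix_rel; first exact: M_crowded.
  by apply: contrapT => EA; apply: no; exists A.
apply: (@powerset_not_embeds (nat -> bool)).
apply: embeds_trans (@embeds_countable_powerset (seq bool * seq bool)%type).
exists c => A A' cAA'; apply: independent_inj; apply/funext => y; apply/propext.
by rewrite !cP cAA'.
Qed.

(** Glue the F j along an injection e of J in the Cantor space, then add a summand
    M A that is not below the result. *)
Lemma strict_upper_bound (J : Type) (F : J -> set (nat -> bool)) :
  embeds J (nat -> bool) ->
  exists E, forall j, tukey_space_ge E (F j) /\ ~ tukey_space_ge (F j) E.
Proof.
move=> [e eI].
pose X r : set (nat -> bool) := [set x | exists2 j, e j = r & F j x].
have XE j : X (e j) = F j.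
  apply/seteqP; split=> [x [j' /eI -> //]|x Fx]; by exists j.
pose U := gather setT X.
have UF j : tukey_space_ge U (F j) by rewrite -XE; exact: gather_fiber.
have [A UA] := not_upper_bound U.
pose G r := if pselect (r = spike 0) then U else M A.
pose E := gather [set spike 0; spike 1] G.
have EU : tukey_space_ge E U.
  have := @gather_fiber [set spike 0; spike 1] G (spike 0) (or_introl erefl).
  by rewrite {3}/G; case: pselect.
have EA : tukey_space_ge E (M A).
  have := @gather_fiber [set spike 0; spike 1] G (spike 1) (or_intror erefl).
  by rewrite {3}/G; case: pselect => // h; have := spike_inj h.
exists E => j; split; first exact: tukey_space_ge_trans (UF j).
move=> FE; apply: UA; apply: tukey_space_ge_trans (UF j) _.
exact: tukey_space_ge_trans EA.
Qed.

(** If n is in A but not in B, the point spike n tells the index of its own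
    summand from the indices of all the summands over B. *)
Lemma gather_spike_le (A B : set nat) :
  A `<=` B <-> tukey_space_ge (gather (spike @` B) (M \o set1)) (gather (spike @` A) (M \o set1)).
Proof.
split=> [AB|ge n An].
  apply: gather_mono; first exact: image_subset.
  move=> _ [k Bk <-] kA; exists k.+1 => _ [l Al <-] /agree_spike kl.
  by apply: kA; exists k; rewrite // kl.
apply: contrapT => Bn.
apply: (M_indep (A' := [set spike n]) (A := set1) (B := B) (a := spike n)).
  move=> k Bk /= kn; have /spike_inj nk : spike n = spike k by apply/kn.
  by apply: Bn; rewrite nk.
apply: tukey_space_ge_trans ge _.
by apply: (@gather_fiber _ (M \o set1) (spike n)); exists n.
Qed.

End independent_families.

(** * Counting Tukey types *)

Lemma countable_base (R : realType) (X : topologicalType) :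
  separable_space X -> metrizable R X ->
  exists B : nat -> set X, (forall n, open (B n)) /\
    forall x U, nbhs x U -> exists2 n, B n x & B n `<=` U.
Proof.
move=> [D [cD dD]] /metrizable_balls[d [d0 dC dT ballo nball]].
have /countable_injP[e eI] := cD.
pose B m : set X := [set y | exists q n,
  [/\ D q, m = pickle (e q, n) & d q y < n.+1%:R^-1]].
exists B; split=> [m|x U].
  rewrite openE => y [q [n [Dq -> qy]]].
  apply: filterS (open_nbhs_nbhs (conj (ballo q n.+1%:R^-1) qy)) => z qz.
  by exists q, n.
move=> /nball[r r0 rU].
pose n := Num.truncn (r / 2)^-1.
have nr : n.+1%:R^-1 < r / 2 by rewrite invf_plt ?posrE ?divr_gt0 ?ltr0n // truncnS_gt.
have [|q [/= xq Dq]] := dD [set y | d x y < n.+1%:R^-1] _ (ballo _ _).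
  by exists x; rewrite /= (proj2 (d0 x x) erefl) invr_gt0 ltr0n.
exists (pickle (e q, n)); first by exists q, n; split => //; rewrite dC.
move=> y [q' [n' [Dq' /(pcan_inj pickleK)[eq <-] q'y]]].
have qq : q = q' by apply: eI; rewrite ?inE.
apply: rU => /=; apply: le_lt_trans (dT x q y) _.
rewrite (splitr r); apply: ltrD; first exact: lt_trans nr.
by rewrite qq; exact: lt_trans nr.
Qed.

(** E is the set of traces of the points of X on a countable base B.  It
    determines X up to homeomorphism, and there are only as many such E as sets of
    reals. *)
Definition coded_by (X : topologicalType) (E : set (set nat)) : Prop :=
  exists B : nat -> set X, [/\ forall n, open (B n),
    forall x U, nbhs x U -> exists2 n, B n x & B n `<=` U &
    E = range (fun x => [set n | B n x])].

(** Matching the points with equal traces is a homeomorphism. *)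
Lemma coded_by_tukey_ge (X Y : topologicalType) (E : set (set nat)) :
  hausdorff_space X -> hausdorff_space Y ->
  coded_by X E -> coded_by Y E -> tukey_ge (kspace Y) (kspace X).
Proof.
move=> hX hY [B [Bo Bb EX]] [C [Co Cb EY]].
have /choice[f fP] : forall x, exists y, [set n | C n y] = [set n | B n x].
  move=> x; have : E [set n | B n x] by rewrite EX; exists x.
  by rewrite EY => -[y _ yx]; exists y.
have BC x n : B n x <-> C n (f x).
  by have := congr1 (@^~ n) (fP x) => /= ->.
apply: (kspace_closed_embedding (f := f)) => //.
- move=> x y fxy; apply: hX => U V /Bb[m Bmx mU] /Bb[n Bny nV].
  exists x; split; first exact: mU.
  by apply: nV; apply/BC; rewrite fxy; apply/BC.
- move=> x U; split=> [/Bb[n Bnx nU]|[V /Cb[n Cnx nV] VU]].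
    exists (C n); first by apply: open_nbhs_nbhs; split; [exact: Co|exact/BC].
    by move=> z /= /BC /nU.
  apply: (@filterS _ _ _ (B n)); first by move=> z /BC /nV /VU.
  by apply: open_nbhs_nbhs; split; [exact: Bo|exact/BC].
- rewrite (_ : range f = setT); first exact: closedT.
  apply/seteqP; split => // y _.
  have : E [set n | C n y] by rewrite EY; exists y.
  rewrite EX => -[x _ xy]; exists x => //.
  apply: hY => U V /Cb[m Cmx mU] /Cb[n Cny nV]; exists y; split; last exact: nV.
  apply: mU; have := congr1 (@^~ m) xy => /= <-.
  exact/BC.
Qed.

Section tukey_types.
Variable R : realType.

Definition type_of (M : sepMetrizable R) : tukey_type R :=
  exist _ (tukey_class M) (ex_intro _ M erefl).

Lemma type_of_le (M N : sepMetrizable R) :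
  tukey_type_le (type_of M) (type_of N) <-> tukey_ge (kspace N) (kspace M).
Proof. by apply: tukey_type_leP; split; exact: tukey_ge_refl. Qed.

Lemma sepMetrizable_hausdorff (M : sepMetrizable R) : hausdorff_space M.
Proof. exact: metrizable_hausdorff (sm_metrizable M). Qed.

(** The code of a type is the code of one of its members.  It is chosen without
    choosing the member, the choice thus bearing on sets of sets of integers
    only. *)
Lemma tukey_type_code : exists h : tukey_type R -> set (set nat), injective h.
Proof.
have code (C : tukey_type R) : exists E, exists2 M, sval C M & coded_by M E.
  have [M CM] := svalP C.
  have [B [Bo Bb]] := countable_base (sm_separable M) (sm_metrizable M).
  exists (range (fun x => [set n | B n x])), M; last by exists B.
  by rewrite CM; split; exact: tukey_ge_refl.
exists (fun C => sval (cid (code C))) => C D.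
case: (cid (code C)) => E [M CM ME]; case: (cid (code D)) => E' [N DN NE] /= EE.
rewrite -{}EE in NE.
have hM := @sepMetrizable_hausdorff M; have hN := @sepMetrizable_hausdorff N.
apply: tukey_type_le_anti.
  by apply/(tukey_type_leP CM DN); exact: coded_by_tukey_ge ME NE.
by apply/(tukey_type_leP DN CM); exact: coded_by_tukey_ge NE ME.
Qed.

End tukey_types.

(** * Order embeddings and the theorem *)

Lemma order_embeds_trans T U V leT leU leV :
  @order_embeds T U leT leU -> @order_embeds U V leU leV -> @order_embeds T V leT leV.
Proof.
by move=> [f fE] [g gE]; exists (g \o f) => x y; rewrite fE gE.
Qed.

Lemma reals_order_embed (R : realType) (P : R -> Prop) :
  order_embeds (fun x y : {x : R | P x} => sval x <= sval y)
    (fun A B : set nat => A `<=` B).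
Proof.
exists (fun x => [set n | exists2 q : rat, n = pickle q & ratr q < sval x]) => x y.
split=> [xy _ [q -> qx]|sub]; first by exists q => //; exact: lt_le_trans xy.
rewrite leNgt; apply/negP => yx.
have [q] := rat_in_itvoo yx; rewrite in_itv /= => /andP[yq qx].
have [|q' /(pcan_inj pickleK) <-] := sub (pickle q); first by exists q.
by move=> /(lt_trans yq); rewrite ltxx.
Qed.

Section order_embeddings.
Variables (R : realType) (M : set (nat -> bool) -> set (nat -> bool)).
Hypotheses (M_crowded : forall A, crowded (M A)) (M_indep : independent M).

(** By recursion, each space is a strict upper bound of the earlier ones, which
    are at most continuum many by the choice of W. *)
Lemma succ_cardinal_order_embeds (W : eqType) (le : rel W) :
  is_succ_cardinal R le ->
  order_embeds (fun x y : W => le x y) (@tukey_type_le R).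
Proof.
move=> [wo _ small].
have [wf tri trans leE] := well_order_strict wo.
have [||f fP] := @wf_rec_spec W _ _ set0
  (fun w f E => forall u, le u w /\ u <> w ->
     tukey_space_ge E (f u) /\ ~ tukey_space_ge (f u) E) wf.
- by move=> w f g E fg fE u uw; rewrite -fg //; exact: fE.
- move=> w f _.
  have [|E EP] := strict_upper_bound M_crowded M_indep
    (J := {u | le u w /\ u <> w}) (fun u => f (sval u)).
    apply: embeds_trans (real_embeds_cantor R); apply/embeds_card.
    apply: card_le_trans (small w).
    rewrite -(card_le_eql (inj_card_eq (f := sval) (in2W (@sval_inj _ _)))).
    by apply: subset_card_le => _ [u _ <-]; exact: svalP u.
  by exists E => u uw; exact: (EP (exist _ u uw)).
exists (fun w => type_of (csub_space R (f w))) => x y; rewrite type_of_le /=.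
split=> [xy|ge].
  have [->|/eqP xNy] := eqVneq x y; first exact: tukey_ge_refl.
  by have [] := fP y x (conj xy xNy).
by apply/leE => yx; have [_] := fP x y yx; apply.
Qed.

Lemma powerset_order_embeds :
  order_embeds (fun A B : set nat => A `<=` B) (@tukey_type_le R).
Proof.
exists (fun A => type_of (csub_space R (gather (spike @` A) (M \o set1)))) => A B.
by rewrite type_of_le; exact: gather_spike_le.
Qed.

End order_embeddings.

Theorem theorem3p13 (R : realType) :
  [/\ equinumerous (tukey_type R) (set R),
      exists F : sepMetrizable R -> Prop,
        equinumerous {M : sepMetrizable R | F M} (set R) /\
        (forall M N : sepMetrizable R, F M -> F N -> M <> N ->
           ~ tukey_ge (kspace M) (kspace N)) &
      [/\ forall (W : eqType) (le : rel W), is_succ_cardinal R le ->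
            order_embeds (fun x y : W => le x y) (@tukey_type_le R),
          order_embeds (fun x y : {x : R | 0 <= x <= 1} => sval x <= sval y)
            (@tukey_type_le R) &
          order_embeds (fun A B : set nat => A `<=` B) (@tukey_type_le R)]].
Proof.
have [M [M_crowded M_indep]] := independent_family.
have antichain := independent_antichain M_indep.
have setCR := embeds_powerset (cantor_embeds_real R).
have setRC := embeds_powerset (real_embeds_cantor R).
pose S A := csub_space R (M A).
have S_anti A A' : A <> A' -> ~ tukey_ge (kspace (S A)) (kspace (S A')) by exact: antichain.
split.
- apply: equinumerous_of_embeds.
    have [h hI] := tukey_type_code R.
    apply: embeds_trans setCR; apply: (@embeds_trans _ (set (set nat))); first by exists h.
    exact: embeds_powerset (@embeds_countable_powerset nat).
  apply: embeds_trans setRC _; exists (fun A => type_of (S A)) => A A' AA'.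
  apply: contrapT => /S_anti; apply; apply/type_of_le; rewrite AA'.
  by apply/type_of_le; exact: tukey_ge_refl.
- exists (fun N => exists A, N = S A); split; last first.
    move=> _ _ [A ->] [A' ->] AA'; apply: S_anti => e; apply: AA'; by rewrite e.
  apply: equinumerous_of_embeds.
    apply: embeds_trans setCR; pose F N := exists A, N = S A.
    exists (fun N : {N | F N} => sval (cid (svalP N))) => N N' e.
    apply: sval_inj; rewrite (svalP (cid (svalP N))) e.
    by rewrite -(svalP (cid (svalP N'))).
  apply: embeds_trans setRC _.
  exists (fun A => exist (fun N => exists A, N = S A) (S A) (ex_intro _ A erefl)).
  move=> A A' /(congr1 sval) /= e; apply: contrapT => /S_anti; apply; rewrite e.
  exact: tukey_ge_refl.
- have powerset := powerset_order_embeds R M_indep; split.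
  + by move=> W le; exact: succ_cardinal_order_embeds.
  + exact: order_embeds_trans (reals_order_embed _) powerset.
  + exact: powerset.
Qed.
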